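(* Let $\Delta=\triangle ABC$ be a proper Möbius triangle with inner angles $\alpha,\beta,\gamma$ all positive (so $\alpha,\beta,\gamma\in(0,\pi)$), and let $\mathbf a,\mathbf b,\mathbf c$ be the oriented cycles containing its sides $BC$, $AC$, $AB$. Let $\mathbf n_a\in\mathcal C(\mathbf b,\mathbf c)$, $\mathbf n_b\in\mathcal C(\mathbf a,\mathbf c)$, $\mathbf n_c\in\mathcal C(\mathbf a,\mathbf b)$ be cevians of the triangle that are distinct (as non-oriented cycles) from $\mathbf a,\mathbf b,\mathbf c$. Then $\mathbf n_a,\mathbf n_b,\mathbf n_c$ are collinear (i.e. belong to one pencil) if and only if $$\frac{\sin\angle(\mathbf b,\mathbf n_a)}{\sin\angle(\mathbf c,\mathbf n_a)}\cdot\frac{\sin\angle(\mathbf c,\mathbf n_b)}{\sin\angle(\mathbf a,\mathbf n_b)}\cdot\frac{\sin\angle(\mathbf a,\mathbf n_c)}{\sin\angle(\mathbf b,\mathbf n_c)}=1.$$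
   Context: The Möbius plane is $\mathbb C\cup\{\infty\}$. A cycle is a Euclidean circle, or a straight line together with $\infty$; equivalently the solution set of $kz\bar z+lz+m\bar z+n=0$ with $\left(\begin{smallmatrix} k & l \\ m & n \end{smallmatrix}\right)$ Hermitian of negative determinant (the matrix is determined up to a nonzero real factor). An oriented cycle is a cycle with a chosen direction of travel. For two distinct cycles $\mathbf a,\mathbf b$ with matrices $M,N$, the pencil $\mathcal C(\mathbf a,\mathbf b)$ is the set of all cycles whose matrix is a real linear combination $xM+yN$; when $\mathbf a,\mathbf b$ meet in two points this is the set of all cycles through these two points. Three cycles are collinear if they belong to one pencil. A triangle $\triangle ABC$ is a part of the plane bounded by three cycle segments $BC, AC, AB$ that pairwise join three distinct points $A,B,C$ and share no other common points; $\mathbf a,\mathbf b,\mathbf c$ are the cycles containing $BC,AC,AB$, oriented so that the triangle lies on the left of every bounding segment. $\alpha,\beta,\gamma$ are the inner angles at $A,B,C$. The triangle is proper if $\alpha,\beta,\gamma\in[0,\pi)$. Its cevians through $A$, $B$, $C$ are the elements of $\mathcal C(\mathbf b,\mathbf c)$, $\mathcal C(\mathbf a,\mathbf c)$, $\mathcal C(\mathbf a,\mathbf b)$ respectively. For oriented cycles $\mathbf p,\mathbf q$ meeting at a point, $\angle(\mathbf p,\mathbf q)\in(-\pi,\pi]$ is the oriented Euclidean angle at that point from the unit tangent vector of $\mathbf p$ to that of $\mathbf q$ (counter-clockwise positive). Within each of the three fractions both angles are measured at the same common point of the cycles, and the cevian is given an arbitrary orientation; the fraction does not depend on these choices. *)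

(* Defs.v *)
From mathcomp Require Import all_boot all_order all_algebra complex.
From mathcomp Require Import boolp classical_sets reals topology normedtype trigo.

Set Implicit Arguments.
Unset Strict Implicit.
Unset Printing Implicit Defensive.

Import Order.TTheory GRing.Theory Num.Theory.
Import numFieldNormedType.Exports.

Local Open Scope classical_set_scope.
Local Open Scope ring_scope.

(* The Möbius plane: [Some z] is the point z of the complex plane, [None] is
   the point at infinity. *)
Definition mplane (R : realType) :=
  one_point_compactification (R[i] : numFieldType).

(* The coordinate z = p + w around a finite point p, and z = 1 / w around
   infinity; in both cases the centre is at w = 0.  Both are conformal and
   orientation-preserving, so angles and sides at infinity are those read in
   the coordinate w. *)
Definition chart (R : realType) (p : mplane R) (w : R[i]) : mplane R :=
  match p with
  | Some z => Some (z + w)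
  | None => if w == 0 then None else Some w^-1
  end.

(* An oriented cycle.  The matrix ((k, l), (m, n)) stands for the cycle
   k z z^* + l z + m z^* + n = 0 travelled so that the side where the left-hand
   side is negative lies on the left.  Positive real factors do not change the
   oriented cycle, and negative ones reverse its direction of travel. *)
Record mcycle (R : realType) := MCycle {
  cycle_mx :> 'M[R[i]]_2;
  cycle_herm : cycle_mx \is hermsymmx;
  cycle_det : \det cycle_mx < 0 }.

(* The underlying non-oriented cycle, as a set of points. *)
Definition cycle_pts (R : realType) (M : mcycle R) : set (mplane R) :=
  [set p | match p with
           | Some z => M 0 0 * (z * z^*) + M 0 1 * z + M 1 0 * z^* + M 1 1 = 0
           | None => M 0 0 = 0
           end].

(* Gradient, in the coordinate [chart p], of (half) the left-hand side f of the
   equation.  At infinity f(1 / w) is first multiplied by w w^*, which gives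
   n w w^* + m w + l w^* + k. *)
Definition cycle_grad (R : realType) (M : mcycle R) (p : mplane R) : R[i] :=
  match p with
  | Some z => M 0 0 * z + M 1 0
  | None => M 0 1
  end.

(* Unit tangent vector at a point p of the cycle, in the direction of travel;
   turning it by a right angle counter-clockwise gives minus the gradient. *)
Definition cycle_tangent (R : realType) (M : mcycle R) (p : mplane R) : R[i] :=
  'i%C * (cycle_grad M p / `|cycle_grad M p|).

(* The oriented angle, in ]- pi, pi], from the unit vector u to the unit
   vector v. *)
Definition unit_angle (R : realType) (u v : R[i]) : R :=
  let w := v / u in
  if 0 <= complex.Im w then acos (complex.Re w) else - acos (complex.Re w).

Definition cycle_angle (R : realType) (p q : mcycle R) (x : mplane R) : R :=
  unit_angle (cycle_tangent p x) (cycle_tangent q x).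

Definition pencil (R : realType) (M N : mcycle R) : set (mcycle R) :=
  [set P | exists x y : R,
     (P : 'M[R[i]]_2) = (x%:C)%C *: (M : 'M_2) + (y%:C)%C *: (N : 'M_2)].

Definition collinear (R : realType) (p q r : mcycle R) : Prop :=
  exists M N : mcycle R, cycle_pts M <> cycle_pts N /\
    [/\ pencil M N p, pencil M N q & pencil M N r].

(* S is one of the two closed arcs into which P and Q divide the cycle. *)
Definition is_segment (R : realType) (M : mcycle R) (P Q : mplane R)
    (S : set (mplane R)) : Prop :=
  [/\ P <> Q, cycle_pts M P, cycle_pts M Q &
    exists2 x, (cycle_pts M `\` [set P; Q]) x &
      S = [set P; Q] `|` connected_component (cycle_pts M `\` [set P; Q]) x].

Definition on_left (R : realType) (T : set (mplane R)) (M : mcycle R)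
    (P Q : mplane R) (S : set (mplane R)) : Prop :=
  forall p, S p -> p <> P -> p <> Q ->
    \forall r \near (0 : R)^'+,
      T (chart p ((r%:C)%C * ('i%C * cycle_tangent M p))).

(* [region] is the triangle itself.  By the Jordan curve theorem the complement
   of the union of the three segments has two connected components, and either
   of them may be the triangle. *)
Record triangle (R : realType) := Triangle {
  vA : mplane R;
  vB : mplane R;
  vC : mplane R;
  side_a : mcycle R;
  side_b : mcycle R;
  side_c : mcycle R;
  seg_BC : set (mplane R);
  seg_AC : set (mplane R);
  seg_AB : set (mplane R);
  region : set (mplane R);
  triangle_segBC : is_segment side_a vB vC seg_BC;
  triangle_segAC : is_segment side_b vA vC seg_AC;
  triangle_segAB : is_segment side_c vA vB seg_AB;
  triangle_meetA : seg_AB `&` seg_AC = [set vA];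
  triangle_meetB : seg_AB `&` seg_BC = [set vB];
  triangle_meetC : seg_AC `&` seg_BC = [set vC];
  triangle_region :
    let outside := ~` (seg_BC `|` seg_AC `|` seg_AB) in
    exists2 x, outside x & region = connected_component outside x;
  triangle_left_a : on_left region side_a vB vC seg_BC;
  triangle_left_b : on_left region side_b vA vC seg_AC;
  triangle_left_c : on_left region side_c vA vB seg_AB }.

Definition cis (R : realType) (t : R) : R[i] := (cos t +i* sin t)%C.

(* The region T has inner angle alpha at the boundary point p: up to an
   arbitrarily small error e in the direction, T coincides near p with a sector
   of opening alpha (in [0, 2 pi]) starting in some direction t0. *)
Definition inner_angle (R : realType) (T : set (mplane R)) (p : mplane R)
    (alpha : R) : Prop :=
  0 <= alpha <= pi *+ 2 /\
  exists t0 : R, forall e : R, 0 < e ->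
    \forall r \near (0 : R)^'+,
      (forall t, t0 + e < t < t0 + alpha - e ->
         T (chart p ((r%:C)%C * cis t))) /\
      (forall t, t0 + alpha + e < t < t0 + pi *+ 2 - e ->
         ~ T (chart p ((r%:C)%C * cis t))).

Definition inner_angles (R : realType) (T : triangle R) (alpha beta gamma : R) :=
  [/\ inner_angle (region T) (vA T) alpha,
      inner_angle (region T) (vB T) beta
    & inner_angle (region T) (vC T) gamma].

(* Main.v *)
(* Near a common point p, a cycle has in [chart p] the equation
   2 dot(g, w) + k |w|^2 = 0, where g is its gradient and |g|^2 = - det.  So
   the sine of the angle between two cycles is the cross product of their
   gradients divided by the square roots of minus the determinants.  If
   n_a = x1 b + y1 c, n_b = x2 a + y2 c and n_c = x3 a + y3 b, the product of
   ratios of sines is - y1 x2 y3 / (x1 y2 x3), while linear dependence of the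
   three cevians reads x1 y2 x3 + y1 x2 y3 = 0, provided that a, b and c are
   linearly independent.

   Independence, and the nonvanishing of all sines, follow from transversality
   of the sides at the vertices.  If two sides were tangent at a vertex, each
   open half-plane bounded by the common tangent would, near the vertex, avoid
   all three segments, hence be either inside or outside the triangle; an angle
   in ]0, pi[ has inner and outer directions in a same half-plane. *)
Require Import Defs.
From mathcomp Require Import all_boot all_order all_algebra complex.
From mathcomp Require Import boolp classical_sets reals topology normedtype trigo.
From mathcomp Require Import ring lra.
Set Implicit Arguments.
Unset Strict Implicit.
Unset Printing Implicit Defensive.
Import Order.TTheory GRing.Theory Num.Theory.
Import numFieldNormedType.Exports.
Local Open Scope classical_set_scope.
Local Open Scope ring_scope.

(** * Equations of cycles in the charts *)

Lemma det_mx22 (K : comRingType) (A : 'M[K]_2) :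
  \det A = A 0 0 * A 1 1 - A 0 1 * A 1 0.
Proof.
rewrite (expand_det_row _ 0) !big_ord_recl big_ord0 /cofactor !det_mx11 !mxE /=.
rewrite addr0 expr0 expr1 mul1r mulN1r mulrN.
by congr (A _ _ * A _ _ - A _ _ * A _ _); apply/val_inj.
Qed.

Definition dot (R : realType) (u v : R[i]) : R :=
  complex.Re u * complex.Re v + complex.Im u * complex.Im v.
Definition cross (R : realType) (u v : R[i]) : R :=
  complex.Re u * complex.Im v - complex.Im u * complex.Re v.

(** The coefficient of |w|^2 in the equation of M read in [chart p]. *)
Definition curvature (R : realType) (M : mcycle R) (p : mplane R) : R :=
  complex.Re (if p is Some _ then M 0 0 else M 1 1).

(* The left-hand side of the equation of M at p; at infinity, the value at
   w = 0 of the equation multiplied by w w^*, as in [cycle_grad]. *)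
Definition cycle_value (R : realType) (M : mcycle R) (p : mplane R) : R :=
  if p is Some z then
    complex.Re (M 0 0) * dot z z + 2 * dot (M 1 0) z + complex.Re (M 1 1)
  else complex.Re (M 0 0).

Lemma cycle_mxP (R : realType) (M : mcycle R) :
  exists k x y n : R, [/\ M 0 0 = (k +i* 0)%C, M 0 1 = (x -i* y)%C,
    M 1 0 = (x +i* y)%C, M 1 1 = (n +i* 0)%C & k * n < x ^+ 2 + y ^+ 2].
Proof.
have /is_hermitianmxP := cycle_herm M.
rewrite expr0 scale1r => H.
have E i j : M i j = ((M j i)^*)%C by rewrite {1}H !mxE.
have := cycle_det M; rewrite det_mx22.
move: (E 0 0) (E 1 1) (E 0 1).
case: (M 0 0) => [k k']; case: (M 0 1) => [x' y']; case: (M 1 0) => [x y].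
case: (M 1 1) => [n n'] /= [hk] [hn] [-> ->].
have -> : k' = 0 by lra.
have -> : n' = 0 by lra.
rewrite ltcE /= => /andP[_ h].
exists k, x, y, n; split=> //; nra.
Qed.

Lemma cycle_ptsE (R : realType) (M : mcycle R) (p : mplane R) :
  cycle_pts M p <-> cycle_value M p = 0.
Proof.
have [k [x [y [n [h00 h01 h10 h11 _]]]]] := cycle_mxP M.
case: p => [[a b]|] /=; rewrite /cycle_pts /= /dot ?h00 ?h01 ?h10 ?h11.
  rewrite -[_^*]/((a -i* b)%C); simpc => /=.
  split => [[h _]|h]; first by lra.
  by congr Complex; lra.
by split=> [[]|/= ->].
Qed.

(** The expansion around p is exact, the equation being quadratic. At infinity, for w nonzero, the
    equation at 1 / w is multiplied by |w|^2. *)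
Lemma cycle_value_chart (R : realType) (M : mcycle R) (p : mplane R) (w : R[i]) :
  cycle_pts M (chart p w) <->
  cycle_value M p + 2 * dot (cycle_grad M p) w + curvature M p * dot w w = 0.
Proof.
rewrite cycle_ptsE.
have [k [x [y [n [h00 h01 h10 h11 _]]]]] := cycle_mxP M.
case: p => [[a b]|] /=; rewrite /curvature /cycle_value /= /dot ?h00 ?h01 ?h10 ?h11.
  case: w => [u v]; simpc => /=.
  by split => h; lra.
case: eqP => [->|/eqP w0] /=.
  by split=> h; lra.
case: w w0 => [u v]; rewrite eq_complex /= => w0.
have d0 : u ^+ 2 + v ^+ 2 != 0 by rewrite paddr_eq0 ?sqr_ge0 // !sqrf_eq0.
have -> : k * (u / (u ^+ 2 + v ^+ 2) * (u / (u ^+ 2 + v ^+ 2)) +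
    - (v / (u ^+ 2 + v ^+ 2)) * - (v / (u ^+ 2 + v ^+ 2))) +
    2 * (x * (u / (u ^+ 2 + v ^+ 2)) + y * - (v / (u ^+ 2 + v ^+ 2))) + n =
    (k + 2 * (x * u + - y * v) + n * (u * u + v * v)) / (u ^+ 2 + v ^+ 2).
  by field.
split=> [/eqP|->]; last by rewrite mul0r.
by rewrite mulf_eq0 invr_eq0 (negPf d0) orbF => /eqP.
Qed.

(* The polarization of - det, viewed as a quadratic form. *)
Definition cycle_form (R : realType) (M N : mcycle R) : R :=
  dot (M 1 0) (N 1 0) -
  (complex.Re (M 0 0) * complex.Re (N 1 1) +
   complex.Re (M 1 1) * complex.Re (N 0 0)) / 2.

(** At a finite p, let f, f' be the left-hand sides of M, N and k, k' their leading coefficients: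
    the two members differ by (k f' + k' f) / 2, which vanishes. So the scalar product of the
    gradients is the same at all common points. *)
Lemma dot_grad (R : realType) (M N : mcycle R) (p : mplane R) :
  cycle_pts M p -> cycle_pts N p ->
  dot (cycle_grad M p) (cycle_grad N p) = cycle_form M N.
Proof.
rewrite !cycle_ptsE /cycle_form /dot.
have [k [x [y [n [h00 h01 h10 h11 _]]]]] := cycle_mxP M.
have [k' [x' [y' [n' [h00' h01' h10' h11' _]]]]] := cycle_mxP N.
case: p => [[a b]|] /=; rewrite /dot ?h00 ?h01 ?h10 ?h11 ?h00' ?h01' ?h10' ?h11';
  simpc => /= h h'; last by rewrite h h'; lra.
have := congr1 (fun t => k * t) h'; have := congr1 (fun t => k' * t) h.
by rewrite !mulr0; lra.
Qed.

Lemma cycle_form_gt0 (R : realType) (M : mcycle R) : 0 < cycle_form M M.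
Proof.
rewrite /cycle_form /dot.
have [k [x [y [n [-> _ -> -> /= h]]]]] := cycle_mxP M.
by lra.
Qed.

(** * Sines of angles between cycles *)

Lemma dot_ge0 (R : realType) (u : R[i]) : 0 <= dot u u.
Proof. by rewrite addr_ge0 // -expr2 sqr_ge0. Qed.

Lemma dot_gt0 (R : realType) (u : R[i]) : (0 < dot u u) = (u != 0).
Proof.
rewrite lt_neqAle dot_ge0 andbT eq_sym /dot -!expr2 paddr_eq0 ?sqr_ge0 //.
by rewrite !sqrf_eq0 eq_complex.
Qed.

Lemma dot_norm (R : realType) (u : R[i]) : `|u| = ((Num.sqrt (dot u u))%:C)%C.
Proof. by rewrite normc_def /dot !expr2. Qed.

Lemma lagrange (R : realType) (u v : R[i]) :
  dot u v ^+ 2 + cross u v ^+ 2 = dot u u * dot v v.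
Proof. by rewrite /dot /cross; ring. Qed.

(** For unit vectors, v / u has real part [dot u v] and imaginary part [cross u v]. The sine of an
    [acos] is nonnegative; the two branches of [unit_angle] restore the sign. *)
Lemma sin_unit_angle (R : realType) (u v : R[i]) :
  dot u u = 1 -> dot v v = 1 -> sin (unit_angle u v) = cross u v.
Proof.
move=> hu hv; rewrite /unit_angle.
have -> : v / u = (dot u v +i* cross u v)%C.
  case: u v hu hv => [a b] [c d]; rewrite /dot /cross /= -!expr2 => hu hv.
  rewrite -[_^-1]/((a / (a ^+ 2 + b ^+ 2) -i* (b / (a ^+ 2 + b ^+ 2)))%C) hu !divr1.
  by simpc; congr Complex; ring.
have := lagrange u v; rewrite hu hv mulr1 /= => h.
have s : 1 - dot u v ^+ 2 = cross u v ^+ 2 by lra.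
have hd : -1 <= dot u v <= 1 by apply/andP; split; nra.
case: ifP => c0; rewrite ?sinN sin_acos // s sqrtr_sqr.
  by rewrite ger0_norm.
by rewrite ltr0_norm ?opprK // ltNge c0.
Qed.

Lemma grad_gt0 (R : realType) (M : mcycle R) (p : mplane R) :
  cycle_pts M p -> 0 < dot (cycle_grad M p) (cycle_grad M p).
Proof. by move=> h; rewrite dot_grad // cycle_form_gt0. Qed.

Lemma dot_tangent (R : realType) (u v : R[i]) (a b : R) :
  dot ('i%C * (u / (a%:C)%C)) ('i%C * (v / (b%:C)%C)) = dot u v / (a * b).
Proof.
rewrite -!fmorphV invfM /dot; case: u v => [x y] [z t].
by simpc => /=; ring.
Qed.

Lemma cross_tangent (R : realType) (u v : R[i]) (a b : R) :
  cross ('i%C * (u / (a%:C)%C)) ('i%C * (v / (b%:C)%C)) = cross u v / (a * b).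
Proof.
rewrite -!fmorphV invfM /cross; case: u v => [x y] [z t].
by simpc => /=; ring.
Qed.

Lemma sin_cycle_angle (R : realType) (M N : mcycle R) (p : mplane R) :
  cycle_pts M p -> cycle_pts N p ->
  sin (cycle_angle M N p) = cross (cycle_grad M p) (cycle_grad N p) /
    (Num.sqrt (cycle_form M M) * Num.sqrt (cycle_form N N)).
Proof.
move=> hM hN; rewrite /cycle_angle /cycle_tangent !dot_norm !dot_grad //.
have unit (P : mcycle R) :
    cycle_form P P / (Num.sqrt (cycle_form P P) * Num.sqrt (cycle_form P P)) = 1.
  by rewrite -expr2 sqr_sqrtr ?ltW ?cycle_form_gt0 // divff // gt_eqF // cycle_form_gt0.
by rewrite sin_unit_angle ?cross_tangent // dot_tangent dot_grad // unit.
Qed.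

(** * Coefficients in a pencil; cycles with three common points *)

Definition coeffs (R : realType) (M N : mcycle R) (x y : R) (P : mcycle R) :=
  (P : 'M[R[i]]_2) = (x%:C)%C *: (M : 'M_2) + (y%:C)%C *: (N : 'M_2).

Lemma coeffs_value (R : realType) (M N P : mcycle R) x y p : coeffs M N x y P ->
  cycle_value P p = x * cycle_value M p + y * cycle_value N p.
Proof.
rewrite /coeffs => h; rewrite /cycle_value h !mxE /dot.
move: (M 0 0) (M 1 0) (M 1 1) (N 0 0) (N 1 0) (N 1 1).
move=> [? ?] [? ?] [? ?] [? ?] [? ?] [? ?].
by case: p => [[? ?]|]; simpc => /=; ring.
Qed.

Lemma coeffs_grad (R : realType) (M N P : mcycle R) x y p : coeffs M N x y P ->
  cycle_grad P p = (x%:C)%C * cycle_grad M p + (y%:C)%C * cycle_grad N p.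
Proof.
by rewrite /coeffs => h; case: p => [z|]; rewrite /cycle_grad h !mxE //; ring.
Qed.

(* The coordinate v = 1 / w on the complement of p, where w is the coordinate of
   [chart p].  A cycle through p is a straight line in this coordinate. *)
Definition far_chart (R : realType) (p : mplane R) (v : R[i]) : mplane R :=
  match p with
  | Some z => if v == 0 then None else Some (z + v^-1)
  | None => Some v
  end.

Lemma far_chartP (R : realType) (p q : mplane R) :
  q <> p -> exists v, q = far_chart p v.
Proof.
case: p q => [z|] [t|] //= h; last by exists t.
  have tz : t - z != 0 by apply/eqP => /eqP; rewrite subr_eq0 => /eqP tz; apply: h; rewrite tz.
  by exists (t - z)^-1; rewrite invr_eq0 (negPf tz) invrK addrC subrK.
by exists 0; rewrite eqxx.
Qed.

(** The equation in [chart p], divided by |w|^2 with w = 1 / v. For finite p, v = 0 is the point at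
    infinity, where the equation says that the leading coefficient is 0. *)
Lemma cycle_far_chart (R : realType) (M : mcycle R) (p : mplane R) (v : R[i]) :
  cycle_pts M p -> cycle_pts M (far_chart p v) ->
  curvature M p + 2 * dot ((cycle_grad M p)^*)%C v = 0.
Proof.
case: p => [z|] hz; last first.
  rewrite cycle_ptsE; move/cycle_ptsE: hz => /=.
  have [k [x [y [n [h00 h01 h10 h11 _]]]]] := cycle_mxP M.
  by rewrite /curvature /dot /= h00 h01 h10 h11 /= => ->; lra.
rewrite [far_chart _ _]/=; case: eqP => [->|/eqP v0].
  by rewrite cycle_ptsE /curvature /dot /= => ->; lra.
move/(cycle_value_chart M (Some z)).
move/cycle_ptsE: hz => ->; move: v0; rewrite -dot_gt0 => v0.
set g := cycle_grad _ _; set k := curvature _ _ => h.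
suff : (k + 2 * dot (g^*)%C v) / dot v v = 0.
  by move/eqP; rewrite mulf_eq0 invr_eq0 (gt_eqF v0) orbF => /eqP.
rewrite -h add0r; move: v0; rewrite /dot; case: v {h} => [a b]; case: g => [c d] /=.
by rewrite -!expr2 => v0; field; rewrite gt_eqF.
Qed.

Lemma cross_eq0 (R : realType) (u v w : R[i]) :
  w != 0 -> dot u w = 0 -> dot v w = 0 -> cross u v = 0.
Proof.
rewrite -dot_gt0 => w0 hu hv; apply/eqP.
have : cross u v * dot w w == 0.
  apply/eqP.
  have -> : cross u v * dot w w =
    dot u w * cross w v - dot v w * cross w u by rewrite /dot /cross; ring.
  by rewrite hu hv !mul0r subr0.
by rewrite mulf_eq0 (gt_eqF w0) orbF.
Qed.

(** Seen from p, both cycles become straight lines through the same two points v and w, so their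
    normals, the conjugate gradients, are both orthogonal to v - w. *)
Lemma tangent_of_three_points (R : realType) (M N : mcycle R) (p q r : mplane R) :
  q <> p -> r <> p -> q <> r ->
  cycle_pts M p -> cycle_pts M q -> cycle_pts M r ->
  cycle_pts N p -> cycle_pts N q -> cycle_pts N r ->
  cross (cycle_grad M p) (cycle_grad N p) = 0.
Proof.
move=> /far_chartP[v ->] /far_chartP[w ->] vw Mp Mq Mr Np Nq Nr.
have vw0 : v - w != 0 by rewrite subr_eq0; apply/eqP => e; apply: vw; rewrite e.
have dotB (u : R[i]) : dot u (v - w) = dot u v - dot u w.
  by rewrite /dot; case: (v) (w) => [a b] [c d] /=; ring.
have K (P : mcycle R) : cycle_pts P p -> cycle_pts P (far_chart p v) ->
    cycle_pts P (far_chart p w) -> dot ((cycle_grad P p)^*)%C (v - w) = 0.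
  by move=> Pp /(cycle_far_chart Pp) e /(cycle_far_chart Pp) e'; rewrite dotB; lra.
have := cross_eq0 vw0 (K M Mp Mq Mr) (K N Np Nq Nr).
by rewrite /cross; case: (cycle_grad M p) (cycle_grad N p) => [a b] [c d] /=; lra.
Qed.

(** * Topology of the charts and of the segments *)

(** A nonempty clopen part of B meets A, being open in B; hence it contains A and, being closed in
    B, it is all of B. *)
Lemma connected_closure_between (X : topologicalType) (A B : set X) :
  connected A -> A `<=` B -> B `<=` closure A -> connected B.
Proof.
move=> cA AB BA U [z Uz] [C1 oC1 UC1] [C2 cC2 UC2].
have AI : A `&` C1 = A `&` C2.
  by rewrite -(setIidl AB) -!setIA -UC1 -UC2.
have : A `&` C1 = A.
  apply: cA; [|by exists C1|by exists C2].
  move: Uz; rewrite UC1 => -[Bz C1z].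
  by have [t At] := BA z Bz C1 (open_nbhs_nbhs (conj oC1 C1z)); exists t.
rewrite AI => /setIidPl AC2; rewrite UC2; apply/setIidPl => t /BA.
by move/closureS: AC2 => /(_ t); rewrite -(iffLR (closure_id _) cC2).
Qed.

Lemma normC_dot_lt (R : realType) (w : R[i]) (e : R) :
  0 < e -> (`|w| < (e%:C)%C) = (dot w w < e ^+ 2).
Proof.
move=> e0; rewrite dot_norm ltcR -{1}(gtr0_norm e0) -sqrtr_sqr ltr_sqrt //.
by rewrite exprn_gt0.
Qed.

Lemma norm_real_complex (R : realType) (t : R) :
  `|(t%:C)%C : R[i]| = (`|t|%:C)%C.
Proof. by rewrite normc_def /= expr0n addr0 sqrtr_sqr. Qed.

Lemma continuous_real_complex (R : realType) :
  continuous (fun t : R => (t%:C)%C : (R[i] : numFieldType)).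
Proof.
(* In the order of [R[i]] a positive radius e is real, so its real part can serve as a radius. *)
move=> t A /nbhs_ballP[e /=]; rewrite ltcE /= => /andP[/eqP e1 e2] eA.
apply/nbhs_ballP; exists (complex.Re e) => //= u tu; apply: eA.
suff : `|(t%:C)%C - (u%:C)%C : R[i]| < ((complex.Re e)%:C)%C.
  by case: e e1 {e2 tu} => [a b] /= ->.
by rewrite -rmorphB norm_real_complex ltcR.
Qed.

Lemma continuous_dot (R : realType) :
  continuous (fun z : (R[i] : numFieldType) => Num.sqrt (dot z z)).
Proof.
move=> z A /nbhs_ballP[e /= e0 eA]; apply/nbhs_ballP.
exists (e%:C)%C => /=; first by rewrite ltcR.
move=> y /= zy; apply: eA; rewrite -ball_normE /= -ltcR.
apply: le_lt_trans zy; apply: le_trans (ler_dist_dist _ _).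
rewrite !dot_norm -rmorphB le_eqVlt; apply/orP; left; apply/eqP.
exact: esym (norm_real_complex _).
Qed.

Lemma compact_dot_bounded (R : realType) (K : set (R[i] : numFieldType)) :
  compact K -> exists2 b : R, 0 < b & forall z, K z -> dot z z < b.
Proof.
move=> cK.
have cK' : compact [set Num.sqrt (dot z z) | z in K].
  by apply: continuous_compact cK; apply: continuous_subspaceT; exact: continuous_dot.
have [b [_ hb]] := compact_bounded cK'.
(* Every number above b is a bound, and [b1] is a positive one; the further 1 added below makes the
   inequality strict. *)
pose b1 := Num.max b 0 + 1.
have b10 : 0 < b1 by rewrite /b1 ltr_wpDl // le_max lexx orbT.
exists ((b1 + 1) ^+ 2) => [|z Kz]; first by rewrite exprn_gt0 // addr_gt0.
have /(_ b1) := hb; have bb : b < b1 by rewrite /b1 ltr_pwDr // le_max lexx.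
move=> /(_ bb (Num.sqrt (dot z z))) /=.
move=> /(_ (ex_intro2 _ _ z Kz erefl)); rewrite ger0_norm ?sqrtr_ge0 // => h.
rewrite -(sqr_sqrtr (dot_ge0 z)).
by have := sqrtr_ge0 (dot z z); move: (Num.sqrt _) h b10 => t; nra.
Qed.

Lemma dot_inv (R : realType) (w : R[i]) : dot w^-1 w^-1 = (dot w w)^-1.
Proof.
have [->|] := eqVneq w 0; first by rewrite invr0 /dot /= !mulr0 addr0 invr0.
rewrite -dot_gt0 /dot; case: w => [a b] /=; rewrite -!expr2 => w0.
by field; rewrite gt_eqF.
Qed.

(** At infinity, U contains the complement of a compact set K; if |z|^2 < b on K, then |w|^2 < 1 / b
    puts 1 / w outside K. *)
Lemma near_chart (R : realType) (p : mplane R) (U : set (mplane R)) :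
  nbhs p U -> exists2 d : R, 0 < d & forall w, dot w w < d -> U (chart p w).
Proof.
case: p => [z|] /=.
  move=> /nbhs_ballP[e /=]; rewrite ltcE /= => /andP[/eqP e1 e2] eU.
  exists (complex.Re e ^+ 2); first by rewrite exprn_gt0.
  move=> w; rewrite -normC_dot_lt // => we; apply: eU.
  rewrite -ball_normE /= opprD addNKr normrN.
  by case: e e1 we {e2} => [a b] /= ->.
case=> K [cK _] KU; have [b b0 hb] := compact_dot_bounded cK.
exists b^-1; first by rewrite invr_gt0.
move=> w wb; case: eqP => [_|/eqP w0]; apply: KU; [by right|left].
exists w^-1 => // /hb; rewrite dot_inv ltNge => /negP; apply.
by rewrite -(invrK b) ler_pV2 ?inE ?unitfE ?invr_eq0 ?gt_eqF ?dot_gt0 ?invr_gt0 // ltW.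
Qed.

Lemma chart_neq (R : realType) (p q : mplane R) : q <> p ->
  exists2 d : R, 0 < d & forall w, dot w w < d -> chart p w <> q.
Proof.
case: p q => [z|] [t|] //= h; [|by exists 1; [exact: ltr01|]|].
  have tz : t - z != 0 by apply/eqP => /eqP; rewrite subr_eq0 => /eqP tz; apply: h; rewrite tz.
  exists (dot (t - z) (t - z)); first by rewrite dot_gt0.
  by move=> w wd [tE]; move: wd; rewrite -tE addrAC subrr add0r ltxx.
exists (dot t t + 1)^-1 => [|w]; first by rewrite invr_gt0 ltr_wpDl ?dot_ge0.
case: eqP => [//|/eqP w0 wd [tE]]; move: wd.
rewrite -tE dot_inv; move: w0; rewrite -dot_gt0; move: (dot w w) => d d0.
rewrite ltNge => /negP; apply; rewrite -{2}(invrK d) ler_pV2 ?inE ?unitfE.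
- by rewrite lerDl.
- by rewrite gt_eqF // addr_gt0 ?invr_gt0.
- by rewrite invr_eq0 gt_eqF ?invr_gt0.
Qed.

Lemma cycle_pts_chart_neq (R : realType) (M : mcycle R) (p : mplane R) :
  ~ cycle_pts M p ->
  exists2 d : R, 0 < d & forall w, dot w w < d -> ~ cycle_pts M (chart p w).
Proof.
rewrite cycle_ptsE; set V := cycle_value M p => V0.
set g := cycle_grad M p; set c := curvature M p.
have V2 : 0 < V ^+ 2 by rewrite exprn_even_gt0 //=; exact/eqP.
have g2 := dot_ge0 g; have c2 := sqr_ge0 c.
have D0 : 0 < 8 * dot g g + 2 * c ^+ 2 + 1 by lra.
(* On the cycle, V^2 = (2 dot g w + c |w|^2)^2 <= (8 |g|^2 + 2 c^2) |w|^2 as soon as |w| <= 1; the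
   summand 1 keeps the denominator positive. *)
exists (Num.min 1 (V ^+ 2 / (8 * dot g g + 2 * c ^+ 2 + 1))).
  by rewrite lt_min ltr01 divr_gt0.
move=> w; rewrite lt_min ltr_pdivlMr // => /andP[w1 wV].
rewrite cycle_value_chart -/V -/g -/c => h.
have := lagrange g w; have := sqr_ge0 (cross g w); have := dot_ge0 w.
move: (dot w w) (dot g w) (dot g g) (cross g w) w1 wV h g2 D0.
move=> s t G x s1 sV h G0 D0 s0 x0 e.
have : V ^+ 2 = (2 * t + c * s) ^+ 2 by rewrite -sqrrN; congr (_ ^+ 2); lra.
have : c ^+ 2 * s * (1 - s) >= 0.
  by apply: mulr_ge0; [exact: mulr_ge0|rewrite subr_ge0 ltW].
have := sqr_ge0 (2 * t - c * s).
nra.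
Qed.

(** Segments are closed. If p is on the cycle and adherent to the component K, then K with p added
    is still connected, and maximality puts p in K. *)
Lemma segment_chart_neq (R : realType) (M : mcycle R) (p P Q : mplane R)
    (S : set (mplane R)) : is_segment M P Q S -> ~ S p ->
  exists2 d : R, 0 < d & forall w, dot w w < d -> ~ S (chart p w).
Proof.
case=> _ _ _ [x Mx ->].
set E := cycle_pts M `\` _; set K := connected_component E x => pS.
have pP : P <> p by move=> e; apply: pS; left; left.
have pQ : Q <> p by move=> e; apply: pS; left; right.
have [dP dP0 hP] := chart_neq pP; have [dQ dQ0 hQ] := chart_neq pQ.
have [d d0 hd] : exists2 d : R, 0 < d & forall w, dot w w < d -> ~ K (chart p w).
  have [Mp|/cycle_pts_chart_neq[d d0 hd]] := pselect (cycle_pts M p); last first.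
    by exists d => // w /hd h /connected_component_sub[].
  have [cK|] := pselect (closure K p).
    case: pS; right; apply: (@connected_component_max _ E (K `|` [set p])).
    - by left; apply: connected_component_refl.
    - move=> y [/connected_component_sub//|->]; split=> //.
      by case=> [e|e]; [apply: pP|apply: pQ].
    - apply: (@connected_closure_between _ K) => //.
      + exact: component_connected.
      + by move=> y [Ky|->] //; exact: subset_closure.
    - by right.
  move=> /existsNP[U] /not_implyP[/near_chart[d d0 hd] KU].
  by exists d => // w /hd Uw Kw; apply: KU; exists (chart p w).
exists (Num.min d (Num.min dP dQ)); first by rewrite !lt_min d0 dP0 dQ0.
move=> w; rewrite !lt_min => /and3P[/hd ? /hP ? /hQ ?].
by case=> [[|]|].
Qed.

(** * Chords in a chart that avoid a cycle *)

(** The hypothesis keeps the chord off the centre, so that in the chart at infinity the formula 1 /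
    w applies and is continuous. *)
Lemma chart_path_connected (R : realType) (p : mplane R) (w1 w2 : R[i]) :
  (forall s : R, 0 <= s <= 1 -> w1 + (s%:C)%C * (w2 - w1) != 0) ->
  connected [set chart p (w1 + (s%:C)%C * (w2 - w1)) | s in `[0, 1]%classic].
Proof.
move=> h.
pose l (s : R) : (R[i] : numFieldType) := w1 + (s%:C)%C * (w2 - w1).
have cl : continuous l.
  move=> s; apply: cvgD; first exact: cvg_cst.
  by apply: cvgM; [exact: continuous_real_complex|exact: cvg_cst].
pose f (s : R) : mplane R :=
  if p is Some z then Some (z + l s) else Some (l s)^-1.
have -> : [set chart p (w1 + (s%:C)%C * (w2 - w1)) | s in `[0, 1]%classic] =
    [set f s | s in `[0, 1]%classic].
  apply: eq_imagel => s /=; rewrite in_itv /= => /h; rewrite -/(l s) /f.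
  by case: p {f} => [//|] /= /negPf ->.
apply: connected_continuous_connected; first exact: segment_connected.
apply: continuous_in_subspaceT => s; rewrite inE /= in_itv /= => /h ls0.
have cl' : {for s, continuous (fun s => if p is Some z then z + l s else (l s)^-1)}.
  case: p {f} => [z|].
    by apply: cvgD; [exact: cvg_cst|exact: cl].
  by apply: cvgV; [exact: ls0|exact: cl].
have -> : f = (fun u : (R[i] : numFieldType) => Some u : mplane R) \o
    (fun s => if p is Some z then z + l s else (l s)^-1).
  by apply/funext => t; rewrite /f /=; case: p {f cl'}.
apply: continuous_comp cl' _.
exact: one_point_compactification_some_continuous.
Qed.

(** As h1 and h2 have the same sign, the linear term is at least 2 r min(|h1|, |h2|) in absolute
    value, and for small r it exceeds the quadratic term, at most |c| B r^2. *)
Lemma quadratic_neq0_near0 (R : realType) (h1 h2 c B : R) :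
  0 < h1 * h2 -> 0 <= B ->
  exists2 d : R, 0 < d & forall r s W, 0 < r < d -> 0 <= s <= 1 -> 0 <= W <= B ->
    2 * (r * ((1 - s) * h1 + s * h2)) + c * (r ^+ 2 * W) != 0.
Proof.
move=> h12 B0; wlog h10 : h1 h2 c h12 / 0 < h1.
  move=> H; have [|h1n] := ltP 0 h1; first exact: H.
  have [||d d0 hd] := H (- h1) (- h2) (- c); first by rewrite mulrNN.
    by rewrite oppr_gt0 lt_neqAle h1n andbT; apply: contraTneq h12 => ->; rewrite mul0r ltxx.
  exists d => // r s W /hd{}hd /hd{}hd /hd; apply: contraNneq => e; lra.
have h20 : 0 < h2 by rewrite pmulr_rgt0 in h12.
have D0 : 0 < `|c| * B + 1 by rewrite ltr_wpDl // mulr_ge0.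
have m0 : 0 < Num.min h1 h2 by rewrite lt_min h10.
exists (2 * Num.min h1 h2 / (`|c| * B + 1)); first by rewrite divr_gt0 ?mulr_gt0.
move=> r s W /andP[r0]; rewrite ltr_pdivlMr // => rd /andP[s0 s1] /andP[W0 WB].
apply/negP => /eqP e.
have e' : 2 * ((1 - s) * h1 + s * h2) + c * (r * W) = 0.
  by apply: (mulfI (lt0r_neq0 r0)); rewrite mulr0 -[RHS]e; ring.
have hm : Num.min h1 h2 <= (1 - s) * h1 + s * h2.
  have m1 : Num.min h1 h2 <= h1 by rewrite ge_min lexx.
  have m2 : Num.min h1 h2 <= h2 by rewrite ge_min lexx orbT.
  have : 0 <= (1 - s) * (h1 - Num.min h1 h2) by rewrite mulr_ge0 ?subr_ge0.
  have : 0 <= s * (h2 - Num.min h1 h2) by rewrite mulr_ge0 ?subr_ge0.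
  lra.
have : - (c * (r * W)) <= `|c| * B * r.
  rewrite -mulNr (le_trans (ler_norm _)) // !normrM normrN (gtr0_norm r0) ger0_norm //.
  rewrite -mulrA [B * r]mulrC ler_wpM2l // ler_wpM2l // ltW //.
lra.
Qed.

Lemma dot_path_le (R : realType) (w1 w2 : R[i]) (s : R) : 0 <= s <= 1 ->
  dot (w1 + (s%:C)%C * (w2 - w1)) (w1 + (s%:C)%C * (w2 - w1)) <=
  (1 - s) * dot w1 w1 + s * dot w2 w2.
Proof.
case/andP=> s0 s1; rewrite -subr_ge0.
have -> : (1 - s) * dot w1 w1 + s * dot w2 w2 -
    dot (w1 + (s%:C)%C * (w2 - w1)) (w1 + (s%:C)%C * (w2 - w1)) =
    s * (1 - s) * dot (w1 - w2) (w1 - w2).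
  by rewrite /dot; case: w1 w2 => [a b] [x y]; simpc => /=; ring.
by rewrite !mulr_ge0 ?dot_ge0 ?subr_ge0.
Qed.

(** The directions w1 and w2 lie strictly on one side of the tangent at p, so the linear term of the
    equation keeps its sign along the chord and dominates for small r. *)
Lemma cycle_pts_path_neq (R : realType) (M : mcycle R) (p : mplane R) (w1 w2 : R[i]) :
  cycle_pts M p -> 0 < dot (cycle_grad M p) w1 * dot (cycle_grad M p) w2 ->
  exists2 d : R, 0 < d & forall r s : R, 0 < r < d -> 0 <= s <= 1 ->
    ~ cycle_pts M (chart p ((r%:C)%C * w1 + (s%:C)%C * ((r%:C)%C * w2 - (r%:C)%C * w1))).
Proof.
move=> Mp h12.
have B0 : 0 <= dot w1 w1 + dot w2 w2 by rewrite addr_ge0 ?dot_ge0.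
have [d d0 hd] := quadratic_neq0_near0 (curvature M p) h12 B0.
exists d => // r s /hd{}hd s01; move: (s01) => /hd{}hd.
pose W := dot (w1 + (s%:C)%C * (w2 - w1)) (w1 + (s%:C)%C * (w2 - w1)).
have /hd : 0 <= W <= dot w1 w1 + dot w2 w2.
  rewrite dot_ge0 /=; apply: le_trans (dot_path_le _ _ s01) _.
  case/andP: s01 => s0 s1.
  by apply: lerD; rewrite ler_piMl ?dot_ge0 // gerBl.
move=> /eqP nz; rewrite cycle_value_chart; move/cycle_ptsE: Mp => ->.
apply: contra_not nz => e; rewrite -[RHS]e add0r.
congr (2 * _ + _ * _).
  move: (cycle_grad M p) w1 w2 {h12 hd B0 W e} => [a b] [x y] [z t].
  by rewrite /dot; simpc => /=; ring.
move: w1 w2 {h12 hd B0 e} @W => [x y] [z t] /=.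
by rewrite /dot; simpc => /=; ring.
Qed.

(** * Transversality of the sides at the vertices *)

(** Directions orthogonal to g differ by multiples of pi, so a + d and a + 2 d, with d a third of
    the length of the interval, are not both orthogonal to g. *)
Lemma dot_cis_neq0 (R : realType) (g : R[i]) (a b : R) :
  g != 0 -> a < b < a + pi -> exists2 t, a < t < b & dot g (cis t) != 0.
Proof.
rewrite -dot_gt0 => g0 /andP[ab bpi].
pose d := (b - a) / 3; have d0 : 0 < d by rewrite /d; lra.
have [h|h] := eqVneq (dot g (cis (a + d))) 0; last first.
  by exists (a + d) => //; rewrite /d; apply/andP; split; lra.
exists (a + d + d); first by rewrite /d; apply/andP; split; lra.
apply/negP => /eqP; rewrite /dot /= (cosD (a + d)) (sinD (a + d)) => h'.
have sd : 0 < sin d by apply: sin_gt0_pi; rewrite d0 /d /=; lra.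
have := lagrange g (cis (a + d)); rewrite h expr0n add0r.
have -> : dot (cis (a + d)) (cis (a + d)) = 1 by rewrite /dot /= -!expr2 cos2Dsin2.
suff -> : cross g (cis (a + d)) = 0 by rewrite expr0n mulr1 => e; move: g0; rewrite -e ltxx.
have : sin d * cross g (cis (a + d)) = 0.
  move: h; rewrite /dot /cross /= => h.
  have := congr1 (fun x => x * cos d) h; rewrite mul0r; lra.
by move/eqP; rewrite mulf_eq0 gt_eqF //= => /eqP.
Qed.

Lemma cisDpi (R : realType) (t : R) : cis (t + pi) = - cis t.
Proof. by rewrite /cis cosDpi sinDpi. Qed.

(* If the gradients were parallel, the chord from r w1 to r w2 in [chart p], with
   w1 an inner and w2 an outer direction on the same side of the common tangent,
   would avoid the sides for small r, hence stay in one component. *)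
Lemma transversal_of_inner_angle (R : realType) (M N : mcycle R) (p x : mplane R)
    (O S : set (mplane R)) (alpha : R) :
  cycle_pts M p -> cycle_pts N p ->
  (forall q, ~ cycle_pts M q -> ~ cycle_pts N q -> ~ S q -> O q) ->
  (exists2 d : R, 0 < d & forall w, dot w w < d -> ~ S (chart p w)) ->
  inner_angle (connected_component O x) p alpha -> 0 < alpha < pi ->
  cross (cycle_grad M p) (cycle_grad N p) != 0.
Proof.
move=> Mp Np MNS [dS dS0 hS] [_ [t0 angleP]] /andP[a0 api].
apply/negP => /eqP gMN.
have g0 := grad_gt0 Mp; have g0' := grad_gt0 Np.
have gn : cycle_grad M p != 0 by rewrite -dot_gt0.
set g := cycle_grad M p in gMN g0 gn; set g' := cycle_grad N p in gMN g0'.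
have [t1 t1P ht1] : exists2 t1, t0 < t1 < t0 + alpha & dot g (cis t1) != 0.
  by apply: dot_cis_neq0 => //; apply/andP; split; lra.
have [u uP hu] : exists2 u, t0 + alpha < u < t0 + pi & dot g (cis u) != 0.
  by apply: dot_cis_neq0 => //; apply/andP; split; lra.
(* One of the opposite directions u and u + pi is on the same side as t1; both are outer directions
   because u < t0 + pi. *)
have [t2 t2P h12] : exists2 t2, t0 + alpha < t2 < t0 + pi *+ 2 &
    0 < dot g (cis t1) * dot g (cis t2).
  have : dot g (cis t1) * dot g (cis u) != 0 by rewrite mulf_neq0.
  case: (ltgtP 0 (dot g (cis t1) * dot g (cis u))) => // h _.
    by exists u => //; apply/andP; split; lra.
  exists (u + pi); first by apply/andP; split; lra.
  rewrite cisDpi.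
  have -> : dot g (- cis u) = - dot g (cis u) by rewrite /dot /=; ring.
  by rewrite mulrN oppr_gt0.
(* Since g and g' are parallel, [dot g'] is a nonzero multiple of [dot g]: t1 and t2 are also on one
   side of the tangent of N. *)
have h12' : 0 < dot g' (cis t1) * dot g' (cis t2).
  have K w : dot g' w * dot g g = dot g g' * dot g w.
    have : dot g g' * dot g w - dot g' w * dot g g = - (cross g g' * cross g w).
      by rewrite /dot /cross; ring.
    by rewrite gMN mul0r oppr0 => /eqP; rewrite subr_eq0 => /eqP.
  have gg' : 0 < dot g g' ^+ 2.
    have := lagrange g g'; rewrite gMN expr0n addr0 => ->; exact: mulr_gt0.
  have : 0 < dot g' (cis t1) * dot g g * (dot g' (cis t2) * dot g g).
    by rewrite !K mulrACA -expr2 mulr_gt0.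
  by rewrite mulrACA pmulr_lgt0 // mulr_gt0.
have [d1 d10 hd1] := cycle_pts_path_neq Mp h12.
have [d2 d20 hd2] := cycle_pts_path_neq Np h12'.
have [e [e0 e1 e2]] : exists e : R, [/\ 0 < e, t0 + e < t1 < t0 + alpha - e &
    t0 + alpha + e < t2 < t0 + pi *+ 2 - e].
  exists (Num.min (Num.min (t1 - t0) (t0 + alpha - t1))
    (Num.min (t2 - (t0 + alpha)) (t0 + pi *+ 2 - t2)) / 2).
  set m := Num.min _ _.
  have : 0 < m by rewrite /m !lt_min; apply/andP; split; apply/andP; split; lra.
  have : m <= t1 - t0 /\ m <= t0 + alpha - t1 by rewrite /m !ge_min !lexx !orbT.
  have : m <= t2 - (t0 + alpha) /\ m <= t0 + pi *+ 2 - t2.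
    by rewrite /m !ge_min !lexx !orbT.
  by case=> ? ? [? ?] ?; split; [|apply/andP; split|apply/andP; split]; lra.
(* From r < 1 and r < dS follows r^2 < dS, so the chord stays in the disc that avoids S. *)
have rd : \forall r \near (0 : R)^'+, r < Num.min (Num.min d1 d2) (Num.min 1 dS).
  by apply: nbhs_right_lt; rewrite !lt_min d10 d20 ltr01.
have [r [[rT r0] rlt]] := filter_ex (filterI (filterI (angleP e e0) (nbhs_right_gt 0)) rd).
case: rT => rT1 rT2; have T1 := rT1 _ e1; apply: (rT2 _ e2).
move: rlt; rewrite !lt_min => /andP[/andP[rd1 rd2] /andP[r1 rS]].
set w1 := (r%:C)%C * cis t1 in T1; set w2 := (r%:C)%C * cis t2.
pose L := [set chart p (w1 + (s%:C)%C * (w2 - w1)) | s in `[0, 1]%classic].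
have cL : connected L.
  apply: chart_path_connected => s /(hd1 r s); rewrite r0 rd1 => /(_ isT) hs.
  by apply/negP => /eqP w0; apply: hs; rewrite -/w1 -/w2 w0; case: (p) Mp => [z|] /=;
    rewrite ?addr0 ?eqxx.
rewrite (same_connected_component T1); apply: (@connected_component_max _ O L) => //.
- by exists 0; rewrite /= ?in_itv /= ?lexx ?ler01 // mul0r addr0.
- move=> _ [s + <-]; rewrite /= in_itv /= => s01; apply: MNS.
  + by apply: hd1 => //; rewrite r0 rd1.
  + by apply: hd2 => //; rewrite r0 rd2.
  + apply: hS; apply: le_lt_trans (dot_path_le _ _ s01) _.
    have dr t : dot ((r%:C)%C * cis t) ((r%:C)%C * cis t) = r ^+ 2.
      by rewrite /dot /cis; simpc => /=; rewrite -[RHS]mulr1 -(cos2Dsin2 t); ring.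
    by rewrite !dr -mulrDl subrK mul1r; nra.
- by exists 1; rewrite /= ?in_itv /= ?lexx ?ler01 // mul1r subrKC.
Qed.

(** * Ratios of sines in a pencil *)

(** By [lagrange] and [dot_grad] the square of the cross product is the same at p and q. This
    carries transversality from a vertex to the point where an angle is measured. *)
Lemma cross_grad_neq0 (R : realType) (M N : mcycle R) (p q : mplane R) :
  cycle_pts M p -> cycle_pts N p -> cycle_pts M q -> cycle_pts N q ->
  cross (cycle_grad M p) (cycle_grad N p) != 0 ->
  cross (cycle_grad M q) (cycle_grad N q) != 0.
Proof.
move=> Mp Np Mq Nq; rewrite -sqrf_eq0 -[in X in _ -> X]sqrf_eq0.
have := lagrange (cycle_grad M p) (cycle_grad N p).
have := lagrange (cycle_grad M q) (cycle_grad N q).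
rewrite !dot_grad // => e e'.
by have -> : cross (cycle_grad M p) (cycle_grad N p) ^+ 2 =
    cross (cycle_grad M q) (cycle_grad N q) ^+ 2 by lra.
Qed.

Lemma cycle_mx_neq0 (R : realType) (M : mcycle R) : (M : 'M[R[i]]_2) != 0.
Proof.
by apply/negP => /eqP M0; have := cycle_det M; rewrite M0 det0 ltxx.
Qed.

Lemma coeffsC (R : realType) (M N P : mcycle R) (x y : R) :
  coeffs M N x y P -> coeffs N M y x P.
Proof. by rewrite /coeffs addrC. Qed.

(** With x = 0, P would be a nonzero multiple of N and have the same points. *)
Lemma coeffs_neq0 (R : realType) (M N P : mcycle R) (x y : R) :
  coeffs M N x y P -> cycle_pts P <> cycle_pts N -> x != 0.
Proof.
move=> h; apply: contra_not_neq => x0.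
have y0 : y != 0.
  apply: contraTneq (cycle_mx_neq0 P) => y0.
  by rewrite h x0 y0 !scale0r addr0 eqxx.
apply/funext => p; apply/propext; rewrite !cycle_ptsE (coeffs_value p h) x0 mul0r add0r.
by split=> [/eqP|->]; rewrite ?mulr0 // mulf_eq0 (negPf y0) => /eqP.
Qed.

(** With X the cross product of the gradients of M and N, the gradient of P has cross products y X
    and - x X with them; X and the norm for P cancel in the ratio. *)
Lemma sin_ratio (R : realType) (M N P : mcycle R) (x y : R) (p : mplane R) :
  coeffs M N x y P -> x != 0 ->
  cycle_pts M p -> cycle_pts N p -> cycle_pts P p ->
  cross (cycle_grad M p) (cycle_grad N p) != 0 ->
  sin (cycle_angle M P p) / sin (cycle_angle N P p) =
  - (y / x) * (Num.sqrt (cycle_form N N) / Num.sqrt (cycle_form M M)).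
Proof.
move=> h x0 Mp Np Pp.
rewrite !sin_cycle_angle // (coeffs_grad p h).
have -> : cross (cycle_grad M p) ((x%:C)%C * cycle_grad M p + (y%:C)%C * cycle_grad N p) =
    y * cross (cycle_grad M p) (cycle_grad N p).
  by rewrite /cross; case: (cycle_grad M p) (cycle_grad N p) => [a b] [c d];
    simpc => /=; ring.
have -> : cross (cycle_grad N p) ((x%:C)%C * cycle_grad M p + (y%:C)%C * cycle_grad N p) =
    - x * cross (cycle_grad M p) (cycle_grad N p).
  by rewrite /cross; case: (cycle_grad M p) (cycle_grad N p) => [a b] [c d];
    simpc => /=; ring.
have n0 (Q : mcycle R) : Num.sqrt (cycle_form Q Q) != 0.
  by rewrite gt_eqF // sqrtr_gt0 cycle_form_gt0.
have := n0 M; have := n0 N; have := n0 P.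
move: (cross _ _) (Num.sqrt _) (Num.sqrt _) (Num.sqrt _) => X m' p' n' P0 N0 M0 X0.
by field; rewrite x0 P0 N0 M0 X0.
Qed.

(** * Linear relations between sides and between cevians *)

(** The vector product of s and t works if its third coordinate is nonzero. Otherwise (s1, s2) and
    (t1, t2) are proportional, and a vector orthogonal to a nonzero one among them, completed by u3
    = 0, works. *)
Lemma exists_linear_relation3 (R : realType) (s1 s2 s3 t1 t2 t3 : R) :
  exists u1 u2 u3 : R, [/\ ~ [/\ u1 = 0, u2 = 0 & u3 = 0],
    u1 * s1 + u2 * s2 + u3 * s3 = 0 & u1 * t1 + u2 * t2 + u3 * t3 = 0].
Proof.
have [D0|D0] := eqVneq (s1 * t2 - s2 * t1) 0; last first.
  exists (s2 * t3 - s3 * t2), (s3 * t1 - s1 * t3), (s1 * t2 - s2 * t1).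
  by split; [case=> _ _ /eqP; exact/negP|ring|ring].
have [s0|s0] := pselect (s1 = 0 /\ s2 = 0); last first.
  exists (- s2), s1, 0; split; [|ring|lra].
  by case=> /eqP; rewrite oppr_eq0 => /eqP e2 e1 _; apply: s0.
have [t0|t0] := pselect (t1 = 0 /\ t2 = 0); last first.
  exists t2, (- t1), 0; split; [|by case: s0 => -> ->; ring|ring].
  by case=> e2 /eqP; rewrite oppr_eq0 => /eqP e1 _; apply: t0.
exists 1, 0, 0; case: s0 => -> _; case: t0 => -> _; split; [|ring|ring].
by case=> /eqP; rewrite oner_eq0.
Qed.

Definition mx_relation (R : realType) (M N P : mcycle R) (x y z : R) :=
  (x%:C)%C *: (M : 'M[R[i]]_2) + (y%:C)%C *: (N : 'M_2) + (z%:C)%C *: (P : 'M_2) = 0.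

Lemma mx_relation_grad (R : realType) (M N P : mcycle R) (x y z : R) p :
  mx_relation M N P x y z ->
  (x%:C)%C * cycle_grad M p + (y%:C)%C * cycle_grad N p + (z%:C)%C * cycle_grad P p = 0.
Proof.
move=> h.
have E i j : (x%:C)%C * M i j + (y%:C)%C * N i j + (z%:C)%C * P i j = 0.
  by move/matrixP: h => /(_ i j); rewrite !mxE.
case: p => [w|] /=; last exact: E.
rewrite -[RHS](E 1 0) -[RHS]add0r -[0 in RHS](mul0r w) -(E 0 0); ring.
Qed.

Lemma mx_relation_value (R : realType) (M N P : mcycle R) (x y z : R) p :
  mx_relation M N P x y z ->
  x * cycle_value M p + y * cycle_value N p + z * cycle_value P p = 0.
Proof.
move=> h.
have E i j : (x%:C)%C * M i j + (y%:C)%C * N i j + (z%:C)%C * P i j = 0.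
  by move/matrixP: h => /(_ i j); rewrite !mxE.
rewrite /cycle_value /dot; move: (E 0 0) (E 1 0) (E 1 1).
move: (M 0 0) (M 1 0) (M 1 1) (N 0 0) (N 1 0) (N 1 1) (P 0 0) (P 1 0) (P 1 1).
move=> [k k'] [l l'] [n n'] [k1 k1'] [l1 l1'] [n1 n1'] [k2 k2'] [l2 l2'] [n2 n2'].
simpc => -[e1 _] [e2 e3] [e4 _]; case: p => [[u v]|] //=.
have := congr1 (fun t => t * (u * u + v * v)) e1.
have := congr1 (fun t => t * u) e2; have := congr1 (fun t => t * v) e3.
rewrite !mul0r; lra.
Qed.

Lemma transversal_free (R : realType) (M N P : mcycle R) (y z : R) p :
  cross (cycle_grad N p) (cycle_grad P p) != 0 ->
  mx_relation M N P 0 y z -> y = 0 /\ z = 0.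
Proof.
move=> t /(mx_relation_grad p); move: t.
case: (cycle_grad M p) (cycle_grad N p) (cycle_grad P p) => [a b] [c d] [e f].
rewrite /cross /=; simpc => /= t [h1 h2]; split; apply: (mulIf t); rewrite mul0r.
  have := congr1 (fun x => x * f) h1; have := congr1 (fun x => x * e) h2.
  by rewrite !mul0r; lra.
have := congr1 (fun x => x * d) h1; have := congr1 (fun x => x * c) h2.
by rewrite !mul0r; lra.
Qed.

Lemma mx_relation_rot (R : realType) (M N P : mcycle R) (x y z : R) :
  mx_relation M N P x y z -> mx_relation N P M y z x.
Proof. by rewrite /mx_relation -addrA addrC. Qed.

Lemma mx_relation_pts (R : realType) (M N P : mcycle R) (x y z : R) p :
  mx_relation M N P x y z -> x != 0 -> cycle_pts N p -> cycle_pts P p -> cycle_pts M p.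
Proof.
move=> h x0; rewrite !cycle_ptsE => Np Pp.
move: (mx_relation_value p h); rewrite Np Pp !mulr0 !addr0 => /eqP.
by rewrite mulf_eq0 (negPf x0) => /eqP.
Qed.

Lemma crossC_neq0 (R : realType) (u v : R[i]) : cross u v != 0 -> cross v u != 0.
Proof. by have -> : cross v u = - cross u v; rewrite /cross ?oppr_eq0 //; ring. Qed.

Section Vertices.
Variables (R : realType) (a b c : mcycle R) (A B C : mplane R).
Hypotheses (AB : A <> B) (AC : A <> C) (BC : B <> C).
Hypotheses (bA : cycle_pts b A) (cA : cycle_pts c A) (aB : cycle_pts a B)
  (cB : cycle_pts c B) (aC : cycle_pts a C) (bC : cycle_pts b C).
Hypotheses (tA : cross (cycle_grad b A) (cycle_grad c A) != 0)
  (tB : cross (cycle_grad a B) (cycle_grad c B) != 0)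
  (tC : cross (cycle_grad a C) (cycle_grad b C) != 0).

(** Otherwise a and b would share A, B and C, hence be tangent at C. *)
Lemma sides_not_through_vertices : ~ (cycle_pts a A /\ cycle_pts b B).
Proof.
by case=> aA bB; move: tC; rewrite (tangent_of_three_points AC BC AB) ?eqxx.
Qed.

(** If x or y is 0, transversality at A or B concludes. Otherwise, evaluated at A and at B, the
    relation puts A on a and B on b. *)
Lemma sides_free x y z : mx_relation a b c x y z -> [/\ x = 0, y = 0 & z = 0].
Proof.
move=> h; have h' := mx_relation_rot h.
have [x0|x0] := eqVneq x 0.
  by move: h; rewrite x0 => /(transversal_free tA)[-> ->].
have [y0|y0] := eqVneq y 0.
  by move: h'; rewrite y0 => /(transversal_free (crossC_neq0 tB))[-> ->].
by case: sides_not_through_vertices; split;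
  [exact: mx_relation_pts h x0 bA cA|exact: mx_relation_pts h' y0 cB aB].
Qed.

Variables (n_a n_b n_c : mcycle R) (x1 y1 x2 y2 x3 y3 : R).
Hypotheses (n_aE : coeffs b c x1 y1 n_a) (n_bE : coeffs a c x2 y2 n_b)
  (n_cE : coeffs a b x3 y3 n_c).
Hypotheses (x10 : x1 != 0) (y10 : y1 != 0) (x20 : x2 != 0) (y20 : y2 != 0)
  (x30 : x3 != 0) (y30 : y3 != 0).

(** Independence of the sides gives u2 x2 + u3 x3 = u1 x1 + u3 y3 = u1 y1 + u2 y2 = 0. Then no u_i
    is 0, and these equations cancel the two terms of the goal multiplied by u1 u2 u3. *)
Lemma cevians_dependent u1 u2 u3 : mx_relation n_a n_b n_c u1 u2 u3 ->
  ~ [/\ u1 = 0, u2 = 0 & u3 = 0] -> x1 * y2 * x3 + y1 * x2 * y3 = 0.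
Proof.
move=> h u0.
have : mx_relation a b c (u2 * x2 + u3 * x3) (u1 * x1 + u3 * y3) (u1 * y1 + u2 * y2).
  rewrite /mx_relation -[RHS]h n_aE n_bE n_cE !scalerDr !scalerA -!rmorphM.
  rewrite !rmorphD !scalerDl [X in _ = X + _]addrACA [RHS]addrACA.
  rewrite -[X in _ = X + _]addrA [X in _ = X + _]addrC [X in _ = _ + X]addrC.
  by rewrite [RHS]addrA [X in X + _ = _]addrA.
case/sides_free => e1 e2 e3.
have [u10|u10] := eqVneq u1 0.
  case: u0; move: e2 e3; rewrite u10 !mul0r !add0r => /eqP + /eqP.
  by rewrite !mulf_eq0 (negPf y30) (negPf y20) !orbF => /eqP-> /eqP->.
have [u20|u20] := eqVneq u2 0.
  by move: e3 => /eqP; rewrite u20 mul0r addr0 mulf_eq0 (negPf u10) (negPf y10).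
have [u30|u30] := eqVneq u3 0.
  by move: e2 => /eqP; rewrite u30 mul0r addr0 mulf_eq0 (negPf u10) (negPf x10).
apply: (mulfI (mulf_neq0 (mulf_neq0 u10 u20) u30)); rewrite mulr0.
have -> : u1 * u2 * u3 * (x1 * y2 * x3 + y1 * x2 * y3) =
  (u1 * x1) * (u2 * y2) * (u3 * x3) + (u1 * y1) * (u2 * x2) * (u3 * y3) by ring.
have -> : u1 * x1 = - (u3 * y3) by lra.
have -> : u1 * y1 = - (u2 * y2) by lra.
have -> : u2 * x2 = - (u3 * x3) by lra.
by ring.
Qed.

Lemma collinear_cevians :
  collinear n_a n_b n_c <-> x1 * y2 * x3 + y1 * x2 * y3 = 0.
Proof.
split.
  case=> M [N [_ [[s1 [t1 e1]] [s2 [t2 e2]] [s3 [t3 e3]]]]].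
  have [u1 [u2 [u3 [u0 us ut]]]] := exists_linear_relation3 s1 s2 s3 t1 t2 t3.
  apply: cevians_dependent u0; rewrite /mx_relation e1 e2 e3.
  have -> : 0 = ((u1 * s1 + u2 * s2 + u3 * s3)%:C)%C *: (M : 'M[R[i]]_2) +
      ((u1 * t1 + u2 * t2 + u3 * t3)%:C)%C *: (N : 'M[R[i]]_2).
    by rewrite us ut !scale0r addr0.
  rewrite !rmorphD !rmorphM /= !scalerDr !scalerDl !scalerA.
  by rewrite [X in X + _ = _]addrACA [LHS]addrACA.
move=> D; exists n_a, n_b; split.
  (* If [n_a] and [n_b] had the same points, both would pass through A and B; then [n_b] through A
     puts A on a, and [n_a] through B puts B on b. *)
  move=> e.
  have n_aA : cycle_pts n_a A.
    apply/cycle_ptsE; rewrite (coeffs_value A n_aE).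
    by move/cycle_ptsE: bA => ->; move/cycle_ptsE: cA => ->; rewrite !mulr0 addr0.
  have n_bB : cycle_pts n_b B.
    apply/cycle_ptsE; rewrite (coeffs_value B n_bE).
    by move/cycle_ptsE: aB => ->; move/cycle_ptsE: cB => ->; rewrite !mulr0 addr0.
  apply: sides_not_through_vertices; split.
    move: n_aA; rewrite e => /cycle_ptsE; rewrite (coeffs_value A n_bE) => /eqP.
    move/cycle_ptsE: cA => ->; rewrite mulr0 addr0 mulf_eq0 (negPf x20) => /eqP.
    by move/cycle_ptsE.
  move: n_bB; rewrite -e => /cycle_ptsE; rewrite (coeffs_value B n_aE) => /eqP.
  move/cycle_ptsE: cB => ->; rewrite mulr0 addr0 mulf_eq0 (negPf x10) => /eqP.
  by move/cycle_ptsE.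
split.
- by exists 1, 0; rewrite scale1r scale0r addr0.
- by exists 0, 1; rewrite scale1r scale0r add0r.
(* These coefficients reproduce those of a and b in [n_c]; that of c becomes (x1 y2 x3 + y1 x2 y3) /
   (x1 x2) = 0. *)
exists (y3 / x1), (x3 / x2).
have -> : (n_c : 'M[R[i]]_2) = ((x3 / x2 * x2)%:C)%C *: (a : 'M_2) +
    ((y3 / x1 * x1)%:C)%C *: (b : 'M_2) +
    ((y3 / x1 * y1 + x3 / x2 * y2)%:C)%C *: (c : 'M_2).
  have -> : y3 / x1 * y1 + x3 / x2 * y2 = (x1 * y2 * x3 + y1 * x2 * y3) / (x1 * x2).
    by field; rewrite x10 x20.
  by rewrite !divfK // D mul0r scale0r addr0.
rewrite n_aE n_bE; move: (y3 / x1) (x3 / x2) => l m.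
rewrite !rmorphD !rmorphM /= !scalerDr !scalerDl !scalerA.
by rewrite [RHS]addrACA [X in _ = X + _]addrC.
Qed.

End Vertices.

(** * The criterion for the cevians of a triangle *)

Lemma is_segment_sub (R : realType) (M : mcycle R) (P Q : mplane R) (S : set (mplane R)) :
  is_segment M P Q S -> S `<=` cycle_pts M.
Proof.
by case=> _ MP MQ [x _ ->] y [[->|->]|/connected_component_sub[]].
Qed.

Lemma is_segment_ends (R : realType) (M : mcycle R) (P Q : mplane R) (S : set (mplane R)) :
  is_segment M P Q S -> [/\ P <> Q, cycle_pts M P & cycle_pts M Q] /\ (S P /\ S Q).
Proof.
by case=> PQ MP MQ [x _ ->]; split=> //; split; left; [left|right].
Qed.

(** The norm factors of the three ratios cancel cyclically. The second ratio starts with c, so the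
    coefficients of [n_b] are swapped. *)
Lemma sin_cevian_product (R : realType) (a b c n_a n_b n_c : mcycle R)
    (p_a p_b p_c : mplane R) (x1 y1 x2 y2 x3 y3 : R) :
  coeffs b c x1 y1 n_a -> coeffs a c x2 y2 n_b -> coeffs a b x3 y3 n_c ->
  x1 != 0 -> y2 != 0 -> x3 != 0 ->
  [/\ cycle_pts b p_a, cycle_pts c p_a & cycle_pts n_a p_a] ->
  [/\ cycle_pts a p_b, cycle_pts c p_b & cycle_pts n_b p_b] ->
  [/\ cycle_pts a p_c, cycle_pts b p_c & cycle_pts n_c p_c] ->
  cross (cycle_grad b p_a) (cycle_grad c p_a) != 0 ->
  cross (cycle_grad a p_b) (cycle_grad c p_b) != 0 ->
  cross (cycle_grad a p_c) (cycle_grad b p_c) != 0 ->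
  sin (cycle_angle b n_a p_a) / sin (cycle_angle c n_a p_a) *
  (sin (cycle_angle c n_b p_b) / sin (cycle_angle a n_b p_b)) *
  (sin (cycle_angle a n_c p_c) / sin (cycle_angle b n_c p_c)) =
  - (y1 * x2 * y3 / (x1 * y2 * x3)).
Proof.
move=> n_aE n_bE n_cE x10 y20 x30 [ba ca na] [ab cb nb] [ac bc nc] ta tb tc.
rewrite (sin_ratio n_aE) // (sin_ratio (coeffsC n_bE)) ?(crossC_neq0 tb) //.
rewrite (sin_ratio n_cE) //.
have n0 (Q : mcycle R) : Num.sqrt (cycle_form Q Q) != 0.
  by rewrite gt_eqF // sqrtr_gt0 cycle_form_gt0.
have := n0 a; have := n0 b; have := n0 c.
move: (Num.sqrt _) (Num.sqrt _) (Num.sqrt _) => c' b' a' c0 b0 a0.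
by field; rewrite x10 y20 x30 c0 b0 a0.
Qed.

Theorem theorem11p1 (R : realType) (T : triangle R) (alpha beta gamma : R)
  (Tangles : inner_angles T alpha beta gamma)
  (alpha_proper : 0 < alpha < pi)
  (beta_proper : 0 < beta < pi)
  (gamma_proper : 0 < gamma < pi)
  (n_a n_b n_c : mcycle R)
  (cevian_a : pencil (side_b T) (side_c T) n_a)
  (cevian_b : pencil (side_a T) (side_c T) n_b)
  (cevian_c : pencil (side_a T) (side_b T) n_c)
  (n_a_distinct : [/\ cycle_pts n_a <> cycle_pts (side_a T),
     cycle_pts n_a <> cycle_pts (side_b T)
   & cycle_pts n_a <> cycle_pts (side_c T)])
  (n_b_distinct : [/\ cycle_pts n_b <> cycle_pts (side_a T),
     cycle_pts n_b <> cycle_pts (side_b T)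
   & cycle_pts n_b <> cycle_pts (side_c T)])
  (n_c_distinct : [/\ cycle_pts n_c <> cycle_pts (side_a T),
     cycle_pts n_c <> cycle_pts (side_b T)
   & cycle_pts n_c <> cycle_pts (side_c T)])
  (p_a p_b p_c : mplane R)
  (common_a : [/\ cycle_pts (side_b T) p_a, cycle_pts (side_c T) p_a
                & cycle_pts n_a p_a])
  (common_b : [/\ cycle_pts (side_a T) p_b, cycle_pts (side_c T) p_b
                & cycle_pts n_b p_b])
  (common_c : [/\ cycle_pts (side_a T) p_c, cycle_pts (side_b T) p_c
                & cycle_pts n_c p_c]) :
  collinear n_a n_b n_c <->
  sin (cycle_angle (side_b T) n_a p_a) / sin (cycle_angle (side_c T) n_a p_a) *
  (sin (cycle_angle (side_c T) n_b p_b) / sin (cycle_angle (side_a T) n_b p_b)) *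
  (sin (cycle_angle (side_a T) n_c p_c) / sin (cycle_angle (side_b T) n_c p_c))
  = 1.
Proof.
case: T Tangles cevian_a cevian_b cevian_c n_a_distinct n_b_distinct n_c_distinct
  common_a common_b common_c => A B C a b c BC AC AB reg sBC sAC sAB mA mB mC
  [x _ regE] _ _ _ [/= angA angB angC] [x1 [y1 n_aE]] [x2 [y2 n_bE]] [x3 [y3 n_cE]]
  [_ na_b na_c] [nb_a _ nb_c] [nc_a nc_b _] pa pb pc.
have [[nBC aB aC] [BC_B BC_C]] := is_segment_ends sBC.
have [[nAC bA bC] [AC_A AC_C]] := is_segment_ends sAC.
have [[nAB cA cB] [AB_A AB_B]] := is_segment_ends sAB.
(* Two segments share only a vertex, so each vertex is off the opposite segment, and near it only
   two sides have to be avoided. *)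
have BC_A : ~ BC A by move=> h; apply: nAB; have : (AB `&` BC) A by []; rewrite mB.
have AC_B : ~ AC B by move=> h; apply: nAB; have : (AB `&` AC) B by []; rewrite mA => ->.
have AB_C : ~ AB C by move=> h; apply: nAC; have : (AB `&` AC) C by []; rewrite mA => ->.
have hBC := is_segment_sub sBC; have hAC := is_segment_sub sAC; have hAB := is_segment_sub sAB.
rewrite {}regE in angA angB angC.
have tA : cross (cycle_grad b A) (cycle_grad c A) != 0.
  apply: (transversal_of_inner_angle bA cA _ (segment_chart_neq sBC BC_A) angA) => //.
  by move=> q nb nc nS [[|/hAC]|/hAB].
have tB : cross (cycle_grad a B) (cycle_grad c B) != 0.
  apply: (transversal_of_inner_angle aB cB _ (segment_chart_neq sAC AC_B) angB) => //.
  by move=> q na nc nS [[/hBC|]|/hAB].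
have tC : cross (cycle_grad a C) (cycle_grad b C) != 0.
  apply: (transversal_of_inner_angle aC bC _ (segment_chart_neq sAB AB_C) angC) => //.
  by move=> q na nb nS [[/hBC|/hAC]|].
(* All six coefficients are nonzero because no cevian is a side of its pencil. *)
have x10 := coeffs_neq0 n_aE na_c; have y10 := coeffs_neq0 (coeffsC n_aE) na_b.
have x20 := coeffs_neq0 n_bE nb_c; have y20 := coeffs_neq0 (coeffsC n_bE) nb_a.
have x30 := coeffs_neq0 n_cE nc_b; have y30 := coeffs_neq0 (coeffsC n_cE) nc_a.
have [pab pac _] := pa; have [pba pbc _] := pb; have [pca pcb _] := pc.
rewrite (sin_cevian_product n_aE n_bE n_cE x10 y20 x30 pa pb pc
  (cross_grad_neq0 bA cA pab pac tA) (cross_grad_neq0 aB cB pba pbc tB)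
  (cross_grad_neq0 aC bC pca pcb tC)).
rewrite (collinear_cevians nAB nAC nBC bA cA aB cB aC bC tA tB tC n_aE n_bE n_cE) //.
have D0 : x1 * y2 * x3 != 0 by rewrite !mulf_neq0.
split=> [D|/eqP].
  by apply: (mulIf D0); rewrite mul1r mulNr divfK //; lra.
rewrite -mulNr => /eqP/(congr1 (fun t => t * (x1 * y2 * x3))).
by rewrite divfK // mul1r; lra.
Qed.
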